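(* Let $X$ be a real Banach space, let $f:[a,b]\to X$, and suppose that $md(f,\cdot)$ is continuous at $x\in[a,b]$. Then $$\|f(y)-f(z)\|-md(f,x)|y-z|=o(|x-z|+|x-y|)$$ as $(y,z)\to(x,x)$ with $y,z\in[a,b]$ and $\operatorname{sign}(z-x)=\operatorname{sign}(y-x)$.
   Context: For $f:[a,b]\to X$, the unilateral metric derivatives are $md_{\pm}(f,x)=\lim_{t\to0+}\frac{\|f(x\pm t)-f(x)\|}{t}$. If both exist and are equal (and finite), their common value is the metric derivative $md(f,x)$; at an endpoint of $[a,b]$ only the one-sided limit taken inside $[a,b]$ is used. ''$md(f,\cdot)$ is continuous at $x$'' means that $md(f,s)$ exists for all $s\in[a,b]$ in some neighbourhood of $x$ and $md(f,s)\to md(f,x)$ as $s\to x$, $s\in[a,b]$. *)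

(* Defs.v *)
From HB Require Import structures.
From mathcomp Require Import all_boot all_order all_algebra.
From mathcomp Require Import all_classical all_reals all_analysis.

Set Implicit Arguments.
Unset Strict Implicit.
Unset Printing Implicit Defensive.

Import Order.TTheory GRing.Theory Num.Theory.
Import numFieldNormedType.Exports.

Local Open Scope classical_set_scope.
Local Open Scope ring_scope.

(* A function [a, b] -> X is represented by a total f : R -> X. Nothing below
   depends on the values of f outside [a, b]: the one-sided limits at a point s
   of [a, b] are only taken on a side that stays inside [a, b]. *)
Section MetricDerivative.
Context {R : realType} {X : completeNormedModType R}.
Implicit Types (a b x l : R) (f : R -> X).

Definition is_md_right f x l : Prop :=
  `|f (x + t) - f x| / t @[t --> 0^'+] --> l.

Definition is_md_left f x l : Prop :=
  `|f (x - t) - f x| / t @[t --> 0^'+] --> l.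

Definition is_md a b f x l : Prop :=
  [/\ a <= x <= b, x < b -> is_md_right f x l & a < x -> is_md_left f x l].

Definition ex_md a b f x : Prop := exists l, is_md a b f x l.

(* The default value 0 is taken only where the metric derivative does not
   exist; see is_md_unique and is_mdE. *)
Definition md a b f x : R := xget 0 [set l | is_md a b f x l].

Definition md_continuous_at a b f x : Prop :=
  (\forall s \near within `[a, b] (nbhs x), ex_md a b f s) /\
  md a b f s @[s --> within `[a, b] (nbhs x)] --> md a b f x.

Lemma is_md_unique a b f x l l' :
  a < b -> is_md a b f x l -> is_md a b f x l' -> l = l'.
Proof.
move=> ab [/andP[ax xb] r1 l1] [_ r2 l2].
have [xltb|bx] := ltP x b.
  exact: (cvg_unique (@Rhausdorff R) (r1 xltb) (r2 xltb)).
have altx : a < x by apply: lt_le_trans ab bx.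
exact: (cvg_unique (@Rhausdorff R) (l1 altx) (l2 altx)).
Qed.

Lemma is_mdE a b f x l : a < b -> is_md a b f x l -> md a b f x = l.
Proof.
move=> ab mdl; apply: xget_unique => // l' mdl'.
exact: is_md_unique ab mdl' mdl.
Qed.

End MetricDerivative.

(* Main.v *)
Require Import Defs.
From mathcomp Require Import all_boot all_order all_algebra.
From mathcomp Require Import all_classical all_reals all_analysis.
From mathcomp Require Import lra.

Set Implicit Arguments.
Unset Strict Implicit.
Unset Printing Implicit Defensive.

Import Order.TTheory GRing.Theory Num.Theory.
Import numFieldNormedType.Exports.
Local Open Scope classical_set_scope.
Local Open Scope ring_scope.

(** Let L = md(f, x) and eps > 0.  Near x all metric derivatives are below
    L + eps, so a mean value inequality gives |f y - f z| <= (L + eps) |y - z|.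
    Conversely |f y - f x| and |f z - f x| are L |y - x| and L |z - x| up to
    relative error eps, so the reverse triangle inequality bounds |f y - f z|
    from below by L ||y - x| - |z - x|| - eps (|y - x| + |z - x|); since y and z
    lie on the same side of x, ||y - x| - |z - x|| = |y - z|. *)

Lemma cvg_at_right0_dist_le (R : realType) (g : R -> R) (l e : R) :
  g t @[t --> 0^'+] --> l -> 0 < e ->
  exists2 d, 0 < d & forall t, 0 < t -> t < d -> `|g t - l| <= e.
Proof.
move=> /cvgrPdist_le gl e0; have := gl e e0.
rewrite near_withinE => /nbhs_ballP[d /= d0 H]; exists d => // t t0 td.
rewrite distrC; apply: H => //.
by rewrite /ball /= sub0r normrN gtr0_norm.
Qed.

Lemma dist_div_le (R : realType) (q l e t : R) :
  0 < t -> `|q / t - l| <= e -> `|q - l * t| <= e * t.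
Proof.
move=> t0 H; have -> : q - l * t = (q / t - l) * t.
  by rewrite mulrBl divfK ?gt_eqF.
by rewrite normrM (gtr0_norm t0) ler_wpM2r // ltW.
Qed.

(** Multiplying the difference quotients by the increment merges the two one-sided limits into a
    single estimate that also covers [y = x]. At an endpoint, one of the sides contains no point of
    [a, b]. *)
Lemma is_md_dist_le (R : realType) (X : completeNormedModType R) (a b : R)
    (f : R -> X) (x l e : R) :
  is_md a b f x l -> 0 < e ->
  exists2 d, 0 < d & forall y, a <= y <= b -> `|y - x| < d ->
    `| `|f y - f x| - l * `|y - x| | <= e * `|y - x|.
Proof.
move=> [_ mdr mdl] e0.
have [d1 d10 H1] : exists2 d, 0 < d & forall t, 0 < t -> t < d -> x < b ->
    `| `|f (x + t) - f x| / t - l| <= e.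
  (* When [x] is the right endpoint the claim is vacuous, so any radius will do. *)
  have [xb|bx] := ltP x b; last by exists 1.
  have [d d0 H] := cvg_at_right0_dist_le (mdr xb) e0.
  by exists d => // t t0 td _; exact: H.
have [d2 d20 H2] : exists2 d, 0 < d & forall t, 0 < t -> t < d -> a < x ->
    `| `|f (x - t) - f x| / t - l| <= e.
  have [ax|xa] := ltP a x; last by exists 1.
  have [d d0 H] := cvg_at_right0_dist_le (mdl ax) e0.
  by exists d => // t t0 td _; exact: H.
exists (Num.min d1 d2); first by rewrite lt_min d10.
move=> y /andP[ay yb]; rewrite lt_min => /andP[yd1 yd2].
have [yx|xy|->] := ltgtP y x; last by rewrite !subrr !normr0 !mulr0 subrr normr0.
- have t0 : 0 < x - y by rewrite subr_gt0.
  move: yd2; rewrite distrC (gtr0_norm t0) => yd2.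
  have := dist_div_le t0 (H2 _ t0 yd2 (le_lt_trans ay yx)).
  by rewrite subKr.
- have t0 : 0 < y - x by rewrite subr_gt0.
  move: yd1; rewrite (gtr0_norm t0) => yd1.
  have := dist_div_le t0 (H1 _ t0 yd1 (lt_le_trans xy yb)).
  by rewrite (addrC x) subrK.
Qed.

(** The gap [C - l] serves as the tolerance in the two-sided estimate. *)
Lemma is_md_lt_near (R : realType) (X : completeNormedModType R) (a b : R)
    (f : R -> X) (x l C : R) :
  is_md a b f x l -> l < C ->
  exists2 d, 0 < d & forall y, a <= y <= b -> `|y - x| < d ->
    `|f y - f x| <= C * `|y - x|.
Proof.
move=> mdx lC; have e0 : 0 < C - l by rewrite subr_gt0.
have [d d0 H] := is_md_dist_le mdx e0; exists d => // y yab yx.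
have := le_trans (ler_norm _) (H y yab yx); rewrite mulrBl; lra.
Qed.

(* The supremum c of the t in [u, v] with |f t - f u| <= C (t - u) is attained,
   by the bound to the left of c, and equals v, by the bound to the right of c. *)
Lemma md_mean_value (R : realType) (X : completeNormedModType R) (a b : R)
    (f : R -> X) (C u v : R) :
  u <= v -> a <= u -> v <= b ->
  (forall s, u <= s <= v -> exists2 l, is_md a b f s l & l < C) ->
  `|f v - f u| <= C * (v - u).
Proof.
move=> uv au vb H.
pose S := [set t | u <= t <= v /\ `|f t - f u| <= C * (t - u)].
have Su : S u by split; rewrite ?lexx ?uv // !subrr normr0 mulr0.
have ubS : ubound S v by move=> t [/andP[]].
have supS : has_sup S by split; [exists u | exists v].
(* By the triangle inequality, [S] extends rightwards across any interval on which the bound holds;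
   this is used both to reach [c] and to pass beyond it. *)
have step s t : S s -> s <= t -> t <= v -> `|f t - f s| <= C * (t - s) -> S t.
  move=> [/andP[us sv] Hs] st tv Ht; split; first by rewrite (le_trans us st).
  by have := ler_distD (f s) (f t) (f u); lra.
set c := sup S.
have uc : u <= c by apply: ub_le_sup => //; exists v.
have cv : c <= v by apply: ge_sup => //; exists u.
have [l mdc lC] := H c (introT andP (conj uc cv)).
have [d d0 Hd] := is_md_lt_near mdc lC.
have Sc : S c.
  have [s Ss cs] := sup_adherent d0 supS.
  have sc : s <= c by apply: ub_le_sup => //; exists v.
  apply: (step _ _ Ss sc cv).
  have [/andP[us sv] _] := Ss.
  have c_s : `|s - c| = c - s by rewrite distrC ger0_norm // subr_ge0.
  rewrite distrC -c_s; apply: Hd; last by rewrite c_s; rewrite -/c in cs; lra.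
  by rewrite (le_trans au us) (le_trans sv vb).
have [c_v|vc] := ltP c v; last first.
  by have cE : c = v := le_anti (introT andP (conj cv vc)); rewrite -cE; case: Sc.
have [t [ct tv td]] : exists t, [/\ c < t, t <= v & t - c < d].
  (* A point beyond [c] where the local bound at [c] still applies, cut off at [v]; its membership
     in [S] contradicts the supremum. *)
  exists (Num.min v (c + d / 2)); split.
  - by rewrite lt_min c_v; lra.
  - by rewrite ge_min lexx.
  - have : Num.min v (c + d / 2) <= c + d / 2 by rewrite ge_min lexx orbT.
    lra.
have t_c : `|t - c| = t - c by rewrite gtr0_norm // subr_gt0.
suff /(ub_le_sup (ex_intro _ v ubS)) : S t by rewrite leNgt ct.
apply: (step _ _ Sc (ltW ct) tv); rewrite -[t - c in leRHS]t_c.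
apply: Hd; last by rewrite t_c.
by apply/andP; split; lra.
Qed.

(** The common sign factors out of the difference, leaving [y - z]; if that sign is 0, both points
    equal [x]. *)
Lemma distr_same_sg (R : realDomainType) (x y z : R) :
  Num.sg (z - x) = Num.sg (y - x) -> `| `|y - x| - `|z - x| | = `|y - z|.
Proof.
move=> sg; rewrite (normrEsg (y - x)) (normrEsg (z - x)) sg -mulrBr.
have -> : y - x - (z - x) = y - z by rewrite opprB addrA subrK.
rewrite normrM normr_sg; case: eqVneq => [yx|_]; last by rewrite mul1r.
move: sg; rewrite yx sgr0 => /eqP; rewrite sgr_eq0 => /eqP zx.
by rewrite (subr0_eq yx) (subr0_eq zx) subrr normr0 mulr0.
Qed.

Theorem lemma4p4 (R : realType) (X : completeNormedModType R) (a b : R)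
    (f : R -> X) (x : R) (ab : a < b) (xab : x \in `[a, b])
    (mdf : md_continuous_at a b f x) :
  let F := within [set p : R * R | [/\ p.1 \in `[a, b], p.2 \in `[a, b] &
                                   Num.sg (p.2 - x) = Num.sg (p.1 - x)]]
                  (nbhs (x, x)) in
  (fun p : R * R => `|f p.1 - f p.2| - md a b f x * `|p.1 - p.2|)
  =o_F (fun p : R * R => `|x - p.2| + `|x - p.1|).
Proof.
move=> F; apply/eqoP => e e0.
have [exmd /cvgrPdist_lt mdc] := mdf.
set L := md a b f x in mdc *.
(* Existence guarantees that [xget] returns a genuine derivative and not the default 0. *)
have is_mdP s : ex_md a b f s -> is_md a b f s (md a b f s).
  by move=> /xgetPex; exact.
have mdx : is_md a b f x L.
  by move: exmd; rewrite near_withinE => /nbhs_singleton H; exact/is_mdP/H.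
have [d1 d10 H1] := is_md_dist_le mdx e0.
have [d2 /= d20 H2] : exists2 d, 0 < d & forall s, a <= s <= b -> `|s - x| < d ->
    exists2 l, is_md a b f s l & l < L + e.
  have /nbhs_ballP[d /= d0 H] : \forall s \near x, s \in `[a, b] ->
      ex_md a b f s /\ `|L - md a b f s| < e.
    exact: filterI exmd (mdc e e0).
  exists d => // s sab sx.
  have [||exs Ls] := H s; rewrite ?in_itv //=.
    by rewrite /ball /= distrC.
  exists (md a b f s); first exact: is_mdP.
  by move: Ls; rewrite ltr_distlC => /andP[]; lra.
(* Every point between [u] and [v] is again within [d2] of [x], so the mean value inequality applies
   with constant [L + e]. *)
have upper u v : a <= u <= b -> a <= v <= b -> `|u - x| < d2 -> `|v - x| < d2 ->
    `|f u - f v| <= (L + e) * `|u - v|.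
  wlog vu : u v / v <= u.
    move=> W uab vab ux vx; have [vu|/ltW uv] := leP v u; first exact: W.
    by rewrite distrC (distrC u); exact: W.
  move=> /andP[au ub] /andP[av vb]; rewrite !ltr_distl => /andP[u1 u2] /andP[v1 v2].
  rewrite (ger0_norm (_ : 0 <= u - v)) ?subr_ge0 //.
  apply: (@md_mean_value _ _ a b) => // s /andP[vs su]; apply: H2.
    by rewrite (le_trans av vs) (le_trans su ub).
  by rewrite ltr_distl; apply/andP; split; lra.
rewrite near_withinE; apply/nbhs_ballP; exists (Num.min d1 d2) => /=.
  by rewrite lt_min d10.
move=> [y z] [/=]; rewrite /ball /= !(distrC x) !lt_min.
move=> /andP[y1 y2] /andP[z1 z2] [].
rewrite !in_itv /= => yab zab /distr_same_sg sgE.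
have yz := upper y z yab zab y2 z2.
have := H1 y yab y1; have := H1 z zab z1.
have t1 := ler_distD (f z) (f y) (f x).
have t2 := ler_distD (f y) (f z) (f x).
have t3 : `|y - z| <= `|z - x| + `|y - x|.
  by rewrite [leRHS]addrC (distrC z); exact: ler_distD.
(* This product trades the error [e * |y - z|] of [upper] for the required
   [e * (|z - x| + |y - x|)]. *)
have := mulr_ge0 (ltW e0) (_ : 0 <= `|z - x| + `|y - x| - `|y - z|).
rewrite subr_ge0 => /(_ t3) t4.
rewrite (distrC (f z) (f y)) in t2.
rewrite (ger0_norm (_ : 0 <= `|z - x| + `|y - x|)) ?addr_ge0 //.
rewrite !ler_norml => /andP[z3 z4] /andP[y3 y4]; apply/andP; split; last lra.
(* For the lower bound, whichever of [y], [z] is farther from [x] decides which of the triangle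
   inequalities [t1], [t2] is used. *)
have : L * `|y - z| = L * (`|y - x| - `|z - x|) \/
       L * `|y - z| = L * (`|z - x| - `|y - x|).
  rewrite -sgE; case: (ger0P (`|y - x| - `|z - x|)) => _; first by left.
  by right; rewrite opprB.
by case; lra.
Qed.
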